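(* Assume that $\mathfrak{b}=\mathfrak{c}$. Let $S\subseteq[\mathbb{N}]^{\infty}$ be a $\sqsubseteq^*$-refinement of some $\mathfrak{b}(\sqsubseteq^* )$-scale. Then $S$ has a $\sqsubseteq^*$-refinement $S'$ such that the set $S'\cup\mathrm{Fin}$ (as a subspace of $P(\mathbb{N})$) is $\mathsf{U}_2(\Gamma,\Gamma)$ but not $\mathsf{S}_1(\Gamma,\Gamma)$. Moreover, if $\mathfrak{p}=\mathfrak{c}$, then $S'$ can be taken so that the set $S'\cup\mathrm{Fin}$ is, in addition, $\mathsf{S}_1(\Omega,\Omega)$.
   Context: $\mathbb{N}=\{1,2,\dots\}$. $P(\mathbb{N})$ carries the Cantor space topology (identify sets with characteristic functions in $\{0,1\}^{\mathbb{N}}$). $\mathrm{Fin}$ is the family of finite subsets of $\mathbb{N}$, and $[\mathbb{N}]^\infty$ the family of infinite subsets. Each $a\in[\mathbb{N}]^\infty$ is identified with its increasing enumeration $a(1)<a(2)<\cdots$. ''For almost all $n$'' means for all but finitely many $n$. For $a,b\in\mathbb{N}^{\mathbb{N}}$, $a\le^* b$ means $a(n)\le b(n)$ for almost all $n$. A set is unbounded if it has no $\le^*$-upper bound in $\mathbb{N}^{\mathbb{N}}$. $\mathfrak{b}$ is the minimal cardinality of an unbounded subset of $\mathbb{N}^{\mathbb{N}}$, and $\mathfrak{c}=2^{\aleph_0}$. A set $A\subseteq[\mathbb{N}]^\infty$ is centered if every finite subset of $A$ has infinite intersection; $p\in[\mathbb{N}]^\infty$ is a pseudointersection of $A$ if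 $p\setminus s$ is finite for all $s\in A$; $\mathfrak{p}$ is the minimal cardinality of a centered set with no pseudointersection. For $a,b\in[\mathbb{N}]^\infty$, $a\sqsubseteq^* b$ means that $|a\cap\{b(n),b(n)+1,\dots,b(n+1)\}|\ge 2$ for almost all $n$. A $\mathfrak{b}(\sqsubseteq^* )$-scale is an unbounded set $\{s_\alpha:\alpha<\mathfrak{b}\}\subseteq[\mathbb{N}]^\infty$ with $s_\alpha\sqsubseteq^* s_\beta$ for all $\alpha<\beta<\mathfrak{b}$. For a binary relation $R$ on $[\mathbb{N}]^\infty$, a set $B\subseteq[\mathbb{N}]^\infty$ is an $R$-refinement of $A\subseteq[\mathbb{N}]^\infty$ if there is a surjection $\varphi\colon A\to B$ with $a\,R\,\varphi(a)$ for all $a\in A$. Spaces are infinite Hausdorff. A cover of a space $X$ is a family $\mathcal{U}$ of subsets of $X$ with $X=\bigcup\mathcal{U}$ and $X\notin\mathcal{U}$. $\Gamma(X)$ is the family of infinite open covers $\mathcal{U}$ of $X$ such that each $x\in X$ belongs to all but finitely many members of $\mathcal{U}$. $\Omega(X)$ is the family of open covers $\mathcal{U}$ of $X$ such that every finite subset of $X$ is contained in some member of $\mathcal{U}$. For types of covers $\mathrm{A},\mathrm{B}$: $X$ is $\mathsf{S}_1(\mathrm{A},\mathrm{B})$ if for all $\mathcal{U}_1,\mathcal{U}_2,\dots\in\mathrm{A}(X)$ there are $U_n\in\mathcal{U}_n$ with $\{U_n:n\in\mathbb{N}\}\in\mathrm{B}(X)$; $X$ is $\mathsf{U}_2(\mathrm{A},\mathrm{B})$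 if for all $\mathcal{U}_1,\mathcal{U}_2,\dots\in\mathrm{A}(X)$, none having a two-element subcover, there are $U_n,V_n\in\mathcal{U}_n$ with $\{U_n\cup V_n:n\in\mathbb{N}\}\in\mathrm{B}(X)$. *)

(* Defs.v *)
From HB Require Import structures.
From mathcomp Require Import all_boot all_order all_algebra.
From mathcomp Require Import all_classical all_reals all_analysis.

Set Implicit Arguments.
Unset Strict Implicit.
Unset Printing Implicit Defensive.

Local Open Scope classical_set_scope.
Local Open Scope card_scope.

(** The natural numbers [{1, 2, ...}] of the text are modelled by [nat] through
    the shift [n |-> n + 1], so enumerations start at index [0].  [P(N)] is
    [cantor_space], whose points are characteristic functions. *)

Definition elts (a : cantor_space) : set nat := [set n | a n].

Definition Fin : set cantor_space := [set a | finite_set (elts a)].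

Definition infsets : set cantor_space := [set a | infinite_set (elts a)].

(** The default value [id] is only taken when [a] is finite. *)
Definition enumeration (a : cantor_space) : nat -> nat :=
  xget (id : nat -> nat) [set f : nat -> nat | increasing_seq f /\ range f = elts a].

Lemma enumerationP (a : cantor_space) : infsets a ->
  increasing_seq (enumeration a) /\ range (enumeration a) = elts a.
Proof.
move=> inf_a.
have cofinal n : exists m, (n <= m)%N && a m.
  apply: contrapT => none; apply: inf_a.
  apply: (@sub_finite_set _ _ `I_n); last exact: finite_II.
  move=> m am /=; rewrite ltnNge; apply/negP => nm.
  by apply: none; exists m; rewrite nm.
pose next n := ex_minn (cofinal n).
have nextP n : [/\ (n <= next n)%N, a (next n)
    & forall m, (n <= m)%N -> a m -> (next n <= m)%N].
  rewrite /next; case: ex_minnP => m /andP[nm am] min_m.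
  by split=> // k nk ak; apply: min_m; rewrite nk.
pose f := fix f n := if n is k.+1 then next (f k).+1 else next 0%N.
suff incr_f : [set f : nat -> nat | increasing_seq f /\ range f = elts a] f.
  by apply: (@xgetPex _ (id : nat -> nat)
    [set f : nat -> nat | increasing_seq f /\ range f = elts a]); exists f.
have lt_f n : (f n < f n.+1)%N by have [] := nextP (f n).+1.
split; first exact/increasing_seqP.
have le_f n : (n <= f n)%N by elim: n => // n /leq_ltn_trans; apply; exact: lt_f.
have below n k : a k -> (k < f n)%N -> range f k.
  move=> ak; elim: n => [|n IHn] kf.
    have [_ _ /(_ k isT ak)] := nextP 0%N.
    by rewrite leqNgt kf.
  have [/IHn//|fk|kf_eq] := ltngtP k (f n); last by exists n.
  have [_ _ /(_ k fk ak)] := nextP (f n).+1.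
  by rewrite leqNgt kf.
apply/seteqP; split=> [_ [n _ <-]|k ak].
  by case: n => [|n] /=; [have [] := nextP 0%N|have [] := nextP (f n).+1].
by apply: (below k.+1) => //; exact: leq_trans (le_f k.+1).
Qed.

Definition le_star (f g : nat -> nat) : Prop :=
  \forall n \near \oo, (f n <= g n)%N.

Definition unbounded (A : set (nat -> nat)) : Prop :=
  ~ exists g, forall f, A f -> le_star f g.

(** [index_iota m n.+1] lists the closed interval [{m, ..., n}]. *)
Definition sqsub_star (a b : cantor_space) : Prop :=
  \forall n \near \oo,
    (2 <= count a (index_iota (enumeration b n) (enumeration b n.+1).+1))%N.

Definition centered (A : set cantor_space) : Prop :=
  forall F : set cantor_space, finite_set F -> F `<=` A ->
    infinite_set (\bigcap_(a in F) elts a).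

Definition pseudointersection (A : set cantor_space) (p : cantor_space) : Prop :=
  infsets p /\ forall s, A s -> finite_set (elts p `\` elts s).

(** Cardinals are represented by sets up to [#=]: [min_card P K] says that
    the minimal cardinality of a set satisfying [P] is that of [K]. *)
Definition min_card (T U : Type) (P : set (set T)) (K : set U) : Prop :=
  (exists A, P A /\ A #= K) /\ (forall A, P A -> K #<= A).

Definition card_is_b (U : Type) (K : set U) : Prop := min_card unbounded K.

Definition card_is_p (U : Type) (K : set U) : Prop :=
  min_card [set A | A `<=` infsets /\ centered A /\
                    ~ exists p, pseudointersection A p] K.

Definition continuum : set cantor_space := setT.

(** [le] well-orders [I] in the order type of a cardinal (initial ordinal). *)
Definition initial_ordinal (I : Type) (le : rel I) : Prop :=
  wochoice.well_order le /\
  forall i, ~ ([set: I] #<= [set j | le j i /\ j <> i]).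

Definition b_scale (D : set cantor_space) : Prop :=
  D `<=` infsets /\ unbounded (enumeration @` D) /\
  exists (I : Type) (le : rel I) (s : I -> cantor_space),
    initial_ordinal le /\ card_is_b [set: I] /\ D = range s /\
    forall i j, le i j -> i <> j -> sqsub_star (s i) (s j).

(** [refinement R A B]: [B] is an [R]-refinement of [A]. *)
Definition refinement (R : cantor_space -> cantor_space -> Prop)
    (A B : set cantor_space) : Prop :=
  A `<=` infsets /\ B `<=` infsets /\
  exists phi : cantor_space -> cantor_space,
    phi @` A = B /\ forall a, A a -> R a (phi a).

Definition is_cover (X : Type) (U : set (set X)) : Prop :=
  \bigcup_(V in U) V = setT /\ ~ U setT.

Definition open_cover (X : topologicalType) (U : set (set X)) : Prop :=
  is_cover U /\ forall V, U V -> open V.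

Definition cover_type := forall X : topologicalType, set (set (set X)).

Definition Gamma : cover_type := fun X =>
  [set U | open_cover U /\ infinite_set U /\
           forall x : X, finite_set [set V | U V /\ ~ V x]].

Definition Omega : cover_type := fun X =>
  [set U | open_cover U /\
           forall F : set X, finite_set F -> exists V, U V /\ F `<=` V].

Definition S1 (A B : cover_type) (X : topologicalType) : Prop :=
  forall U : nat -> set (set X), (forall n, A X (U n)) ->
  exists V : nat -> set X, (forall n, U n (V n)) /\ B X (range V).

Definition two_element_subcover (X : Type) (U : set (set X)) : Prop :=
  exists V W : set X, U V /\ U W /\ V <> W /\ is_cover [set V; W].

Definition U2 (A B : cover_type) (X : topologicalType) : Prop :=
  forall U : nat -> set (set X),
  (forall n, A X (U n) /\ ~ two_element_subcover (U n)) ->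
  exists V W : nat -> set X, (forall n, U n (V n) /\ U n (W n)) /\
    B X (range (fun n => V n `|` W n)).

(* Main.v *)
Require Import Defs.
From mathcomp Require Import all_boot all_order all_algebra.
From mathcomp Require Import all_classical all_reals all_analysis.
From mathcomp Require Import zify.

Set Implicit Arguments.
Unset Strict Implicit.
Unset Printing Implicit Defensive.

Local Open Scope classical_set_scope.

(** The scale provides two things: its index set is a well-order of length continuum, and the set
    [S], being unbounded as a refinement of an unbounded set, has size [b], which is the
    continuum.  So [S] can be listed as [s i] along that well-order, together with a list of all
    functions on the natural numbers.  Every sufficiently thin set [t i] satisfies
    [sqsub_star (s i) (t i)], so there is complete freedom to thin out further.

    The points [t i] are built by recursion ([sparse_family]).  By [b = c] the point [t i] can be
    made sparse, i.e. with gaps larger than prescribed in terms of their left endpoint, for all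
    rates listed up to stage [i].  Hence for each rate all points are sparse, except for fewer
    than [b] of them.  In addition [t i] infinitely often jumps over a number [n] directly to
    [f n], where [f] is the [i]-th function with [n < f n] for all [n].

    The jumps refute S1(Gamma, Gamma).  For fixed [n], the sets of points whose first element
    after [n] is not [m], for [m > n], form a point-cofinite cover, and a selection from these
    covers is a function [f]; the corresponding [t i] is omitted infinitely often
    ([hitting_not_S1]).

    Sparsity gives U2(Gamma, Gamma).  An open set that contains all finite sets below [a] contains
    all points without elements in [[a, b)] for some [b] ([gap_open]).  Two members of each cover
    are attached to two adjacent intervals, at most one of which is met by a sparse point.  The
    fewer than [b] remaining points are handled by a function dominating their moduli
    ([sparse_U2]).

    For S1(Omega, Omega) the recursion also lists all sequences of families of clopen sets.  If the
    [i]-th one covers the finite subsets of the set [Z] of points constructed before stage [i],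
    then [p = c] yields a point-cofinite selection on [Z], because [Z] has size less than [p].
    After thinning out, this selection remains good when sparse points are added:
    finitely many sparse points avoid a common interval ([small_captures]), and the points
    constructed from stage [i] on are kept sparse for the rate that this requires. *)

(** * Sparse sets *)

Lemma le_starP (f g : nat -> nat) :
  le_star f g <-> exists N, forall n, (N <= n)%N -> (f n <= g n)%N.
Proof. by split=> [[N _ H]|[N H]]; exists N. Qed.

Lemma finite_bounded (A : set nat) : finite_set A -> exists N, forall a, A a -> (a < N)%N.
Proof.
move=> /finite_seqP[s ->]; exists (\max_(i <- s) i).+1 => a /= sa.
by rewrite ltnS; apply: leq_bigmax_seq.
Qed.

Lemma infinite_cofinal (A : set nat) :
  infinite_set A -> forall n, exists m, (n <= m)%N /\ A m.
Proof.
move=> infA n; apply: contrapT => no; apply: infA.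
apply: (@sub_finite_set _ _ `I_n); last exact: finite_II.
move=> m Am /=; rewrite ltnNge; apply/negP => nm; apply: no.
by exists m.
Qed.

Lemma cofinal_infinite (A : set nat) :
  (forall n, exists m, (n <= m)%N /\ A m) -> infinite_set A.
Proof.
move=> cofA /finite_bounded[N ltN]; have [m [Nm Am]] := cofA N.
by have := ltN _ Am; rewrite ltnNge Nm.
Qed.

(** Thinness is measured by lower bounds on the gap after an element in terms of that element
    alone.  Unlike a bound on the enumeration, this is insensitive to where the set starts, and
    finite sets satisfy it vacuously, so that they behave like the thinnest points. *)
Definition sparse (g : nat -> nat) (x : cantor_space) : Prop :=
  exists N, forall a b, (N <= a)%N -> x a -> (a < b)%N -> x b -> (g a < b)%N.

Lemma fin_sparse g x : Fin x -> sparse g x.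
Proof.
move=> /finite_bounded[N ltN]; exists N => a b Na xa.
by have := ltN _ xa; rewrite ltnNge Na.
Qed.

Lemma le_star_sparse f g x : le_star f g -> sparse g x -> sparse f x.
Proof.
move=> /le_starP[N le_fg] [M gx]; exists (maxn N M) => a b.
rewrite geq_max => /andP[Na Ma] xa ab xb.
by apply: leq_ltn_trans (le_fg _ Na) _; exact: gx.
Qed.

(** The greedy choice works: after an element [a] jump to [f n] with [n] the maximum of [a] and
    [g a].  The next element of [t] after [n] is then [f n], however fast [g] grows compared
    with [f]; this is what makes [t] defeat the selection [f] of the covers [not_next_cover]. *)
Lemma sparse_hitting (f g : nat -> nat) : (forall n, (n < f n)%N) ->
  exists t : cantor_space, [/\ infsets t, sparse g t & forall m, exists n,
    [/\ (m <= f n)%N, t (f n) & forall x, (n < x < f n)%N -> ~~ t x]].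
Proof.
move=> gt_f; pose h a := maxn a (g a).
pose u k := iter k (f \o h) 0%N.
have uS k : u k.+1 = f (h (u k)) by [].
have u_incr : {homo u : i j / (i < j)%N}.
  apply: homo_ltn => [? ? ?|k]; first exact: ltn_trans.
  by rewrite uS; apply: leq_ltn_trans (gt_f _); rewrite leq_maxl.
have u_mono : {mono u : i j / (i <= j)%N} by exact: leq_mono.
have u_lt : {mono u : i j / (i < j)%N} by exact: leqW_mono.
have le_u k : (k <= u k)%N by elim: k => // k /leq_ltn_trans; apply; exact: u_incr.
have hits m : exists n, [/\ (m <= f n)%N, `[< exists k, u k = f n >]
    & forall x, (n < x < f n)%N -> ~~ `[< exists k, u k = x >]].
  exists (h (u m)); rewrite -uS; split.
  - exact: leq_trans (leqnSn m) (le_u m.+1).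
  - by apply/asboolP; exists m.+1.
  - move=> x /andP[lt_x x_lt]; apply/asboolPn => -[k uk].
    have : (u m < u k)%N by rewrite uk; apply: leq_ltn_trans lt_x; exact: leq_maxl.
    by move: x_lt; rewrite -uk !u_lt ltnS leqNgt => /negbTE ->.
exists (fun x => `[< exists k, u k = x >]); split => //.
  apply: cofinal_infinite => n; exists (u n); split; first exact: le_u.
  by apply/asboolP; exists n.
exists 0%N => a b _ /asboolP[k <-] + /asboolP[l lb]; rewrite -lb.
rewrite u_lt => kl.
apply: (@leq_ltn_trans (h (u k))); first exact: leq_maxr.
apply: (@leq_trans (u k.+1)); first by rewrite uS gt_f.
by rewrite u_mono.
Qed.

Lemma count_ge2 (a : pred nat) m n x y : (m <= x < y)%N -> (y < n)%N -> a x -> a y ->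
  (2 <= count a (index_iota m n))%N.
Proof.
move=> /andP[mx xy] yn ax ay; rewrite -size_filter.
apply: (@uniq_leq_size _ [:: x; y]); first by rewrite /= inE andbT neq_ltn xy.
move=> z.
rewrite !inE mem_filter mem_index_iota => /orP[]/eqP->.
  by rewrite ax mx (ltn_trans xy).
by rewrite ay yn (leq_trans mx (ltnW xy)).
Qed.

Lemma count_ge2_exists (a : pred nat) m n : (2 <= count a (index_iota m n.+1))%N ->
  exists x, [/\ (m < x)%N, (x <= n)%N & a x].
Proof.
move=> count2; apply: contrapT => none; move: count2.
rewrite -size_filter ltnNge => /negP; apply.
rewrite -[1%N]/(size [:: m]); apply: uniq_leq_size; first by rewrite filter_uniq ?iota_uniq.
move=> x; rewrite mem_filter mem_index_iota ltnS inE => /and3P[ax mx xn].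
apply: contrapT => /negP xm; apply: none; exists x.
by rewrite ltn_neqAle mx eq_sym xm.
Qed.

(** * Refinements and unboundedness *)

Lemma enumeration_lt a : infsets a -> {homo enumeration a : i j / (i < j)%N}.
Proof.
move=> /enumerationP[incr _] i j; rewrite !ltnNge; apply: contra.
by have := incr j i; rewrite !leEnat => ->.
Qed.

Lemma enumeration_ge a : infsets a -> forall n, (n <= enumeration a n)%N.
Proof.
move=> /enumeration_lt lt_a; elim=> // n /leq_ltn_trans; apply; exact: lt_a.
Qed.

Lemma enumeration_mem a : infsets a -> forall n, a (enumeration a n).
Proof.
move=> /enumerationP[_ ran] n.
have : range (enumeration a) (enumeration a n) by exists n.
by rewrite ran.
Qed.

Lemma enumeration_onto a : infsets a -> forall x, a x -> exists n, enumeration a n = x.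
Proof.
move=> /enumerationP[_ ran] x ax.
have : elts a x by [].
by rewrite -ran => -[n _ <-]; exists n.
Qed.

(** It suffices that the gap of [t] after [a] contains two elements of [s]. *)
Lemma sparse_sqsub s : infsets s ->
  exists g, forall t, infsets t -> sparse g t -> sqsub_star s t.
Proof.
move=> inf_s.
have next2 a : exists b, exists x, [/\ (a <= x < b)%N, s x & s b].
  have [x [ax sx]] := infinite_cofinal inf_s a.
  have [b [xb sb]] := infinite_cofinal inf_s x.+1.
  by exists b, x; rewrite ax.
have [g gP] := choice next2; exists g => t inf_t [N gt].
exists N => // n /= Nn; have [x [/andP[ax xb] sx sb]] := gP (enumeration t n).
apply: (@count_ge2 _ _ _ x (g (enumeration t n))) => //; first by rewrite ax.
apply/ltnW/gt; rewrite ?enumeration_mem //; last exact: enumeration_lt.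
exact: leq_trans Nn (enumeration_ge inf_t _).
Qed.

(** Consecutive closed intervals share an endpoint, so the two elements of [d] in each of them
    only guarantee one new element per interval; the shift by [N] cannot be avoided, because
    nothing is known about the first [N] intervals. *)
Lemma sqsub_enumeration d s : infsets d -> infsets s -> sqsub_star d s ->
  exists N, forall k, (enumeration d k <= enumeration s (N + k).+1)%N.
Proof.
move=> inf_d inf_s [N _ NP].
have meet n : (N <= n)%N ->
    exists x, [/\ (enumeration s n < x)%N, (x <= enumeration s n.+1)%N & d x].
  by move=> /NP; exact: count_ge2_exists.
have d_le : {mono enumeration d : i j / (i <= j)%N} by case: (enumerationP inf_d).
exists N; elim=> [|k IHk].
  have [x [_ xs dx]] := meet N (leqnn N).
  have [j jx] := enumeration_onto inf_d dx.
  by rewrite addn0; apply: leq_trans xs; rewrite -jx d_le.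
have [|x [sx xs dx]] := meet (N + k).+1; first by rewrite leqW ?leq_addr.
have [j jx] := enumeration_onto inf_d dx.
rewrite addnS; apply: leq_trans xs; rewrite -jx d_le ltnNge -d_le jx -ltnNge.
exact: leq_ltn_trans sx.
Qed.

(** A bound [g] for the enumerations in [B] bounds those in [A] up to a shift depending on the
    set, and the running maximum of [g] up to [2 k] absorbs every fixed shift at once. *)
Lemma refinement_unbounded A B : refinement sqsub_star A B ->
  unbounded (enumeration @` A) -> unbounded (enumeration @` B).
Proof.
move=> [infA [infB [phi [phiA phiP]]]] unbA [g gB]; apply: unbA.
exists (fun k => \max_(j < k.*2.+1) g j) => _ [d Ad <-]; apply/le_starP.
have Bd : B (phi d) by rewrite -phiA; exists d.
have [N le_ds] := sqsub_enumeration (infA _ Ad) (infB _ Bd) (phiP _ Ad).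
have /le_starP[M le_sg] := gB _ (ex_intro2 _ _ _ Bd erefl).
exists (maxn M N.+1) => k; rewrite geq_max => /andP[Mk Nk].
apply: leq_trans (le_ds k) _.
apply: (@leq_trans (g (N + k).+1)).
  by apply: le_sg; apply: leq_trans Mk _; rewrite leqW ?leq_addl.
have lt_k : ((N + k).+1 < k.*2.+1)%N by rewrite ltnS -addnn -addSn leq_add2r.
exact: (@leq_bigmax _ (fun j : 'I_k.*2.+1 => g j) (Ordinal lt_k)).
Qed.
(** * Well-orders of length continuum *)

Definition below (I : Type) (le : rel I) (i : I) : set I := [set j | le j i /\ j <> i].

Lemma well_order_total (I : Type) (le : rel I) : wochoice.well_order le ->
  forall i j, ~ below le i j -> le i j.
Proof.
move=> wo i j nji.
have [] := wo (fun k => `[< k = i \/ k = j >]); first by exists i; apply/asboolP; left.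
move=> z [[/asboolP zij zmin] _].
have zi : le z i by apply: zmin; apply/asboolP; left.
have zj : le z j by apply: zmin; apply/asboolP; right.
case: zij => ez; subst z => //.
by have [<-|ji] := pselect (j = i); last by case: nji.
Qed.

Lemma below_well_founded (I : Type) (le : rel I) : wochoice.well_order le ->
  well_founded (fun j i => below le i j).
Proof.
move=> wo i; apply: contrapT => nacc.
have [] := wo (fun k => `[< ~ Acc (fun j i => below le i j) k >]).
  by exists i; apply/asboolP.
move=> z [[/asboolP nz zmin] _]; apply: nz; constructor => k [kz kNz].
apply: contrapT => nk; apply: kNz.
have zk : le z k by apply: zmin; apply/asboolP.
have zz : le z z by apply: well_order_total wo _ _ _ => -[].
have kk : le k k by apply: well_order_total wo _ _ _ => -[].
have [] := wo (fun l => `[< l = z \/ l = k >]); first by exists z; apply/asboolP; left.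
move=> m [_ muniq]; transitivity m.
  apply/esym/muniq; split; first by apply/asboolP; right.
  by move=> l /asboolP[]->.
by apply: muniq; split; [apply/asboolP; left|move=> l /asboolP[]->].
Qed.

(** Recursion for a relation: a value related to the previous ones can be picked at every
    stage, provided the relation only looks at the values at earlier stages. *)
Lemma wf_dependent_choice (I B : Type) (b0 : B) (lt : I -> I -> Prop)
    (R : I -> (I -> B) -> B -> Prop) :
  well_founded lt -> (forall i g, exists b, R i g b) ->
  (forall i g g' b, (forall j, lt j i -> g j = g' j) -> R i g b -> R i g' b) ->
  exists g, forall i, R i g (g i).
Proof.
move=> wf ex local.
pose F i g := projT1 (cid (ex i g)).
have FP i g : R i g (F i g) by rewrite /F; case: (cid _).
pose extend i (rec : forall j, lt j i -> B) j :=
  if pselect (lt j i) is left ji then rec j ji else b0.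
pose g := Fix wf (fun=> B) (fun i rec => F i (extend i rec)).
have gE i : g i = F i (extend i (fun j _ => g j)).
  apply: (Fix_eq wf (fun=> B) (fun i rec => F i (extend i rec))) => j r r' rr'.
  congr (F j); apply/funext => k; rewrite /extend.
  by case: (pselect _) => // kj; exact: rr'.
exists g => i; rewrite gE; apply: local (FP _ _) => j ji.
by rewrite /extend; case: (pselect _).
Qed.

Lemma small_bounded (I : Type) (J : set I) (u : I -> nat -> nat) :
  card_is_b continuum -> ~ (continuum #<= J)%card ->
  exists g, forall j, J j -> le_star (u j) g.
Proof.
move=> [_ bmin] small; apply: contrapT => unb; apply: small.
apply: card_le_trans (card_image_le u J); apply: bmin => -[g ug]; apply: unb.
by exists g => j Jj; apply: ug; exists j.
Qed.

(** * Cardinals below the continuum *)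

Lemma continuum_uncountable (T : Type) (A : set T) :
  countable A -> ~ (continuum #<= A)%card.
Proof.
move=> countA cA.
have /pcard_surjP[g g_surj] : (continuum #<= [set: nat])%card by exact: card_le_trans countA.
have [n _ gn] := g_surj (fun n => ~~ g n n) I.
by have := congr1 (fun c => c n) gn; case: (g n n).
Qed.

(** The continuum is its own square.  If [A] contains the preimage of a whole fibre of the first
    projection it has size continuum; otherwise [B] meets every fibre, hence it projects onto
    the continuum, which is impossible for a countable set. *)
Lemma continuum_setU_countable (T : Type) (A B : set T) :
  countable B -> (continuum #<= A `|` B)%card -> (continuum #<= A)%card.
Proof.
move=> countB /pcard_surjP[g g_surj].
pose even_part (c : cantor_space) : cantor_space := fun n => c n.*2.
pose odd_part (c : cantor_space) : cantor_space := fun n => c n.*2.+1.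
pose join (y z : cantor_space) : cantor_space := fun n => if odd n then z n./2 else y n./2.
have even_join y z : even_part (join y z) = y.
  by apply/funext => n; rewrite /even_part /join odd_double doubleK.
have odd_join y z : odd_part (join y z) = z.
  by apply/funext => n; rewrite /odd_part /join /= odd_double uphalf_double.
have [[y fibre]|no_fibre] := pselect (exists y, forall z, (g @` A) (join y z)).
  apply/pcard_surjP; exists (odd_part \o g) => z _.
  by have [a Aa ga] := fibre z; exists a => //=; rewrite ga odd_join.
have [] := continuum_uncountable countB; apply/pcard_surjP.
exists (even_part \o g) => y _; apply: contrapT => nBy; apply: no_fibre.
exists y => z; have [a [Aa|Ba] ga] := g_surj (join y z) I; first by exists a.
by case: nBy; exists a => //=; rewrite ga even_join.
Qed.

Lemma small_pseudointersection (A : set cantor_space) : card_is_p continuum ->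
  A `<=` infsets -> centered A -> ~ (continuum #<= A)%card ->
  exists p, pseudointersection A p.
Proof. by move=> [_ pmin] infA cA small; apply: contrapT => np; apply/small/pmin. Qed.

(** The index set has the minimal size of an unbounded family, and so does the continuum; each is
    therefore at most as large as the other. *)
Lemma continuum_index (D : set cantor_space) : card_is_b continuum -> b_scale D ->
  exists (I : Type) (le : rel I), [/\ wochoice.well_order le,
    (forall i, ~ (continuum #<= below le i)%card) & ([set: I] #= continuum)%card].
Proof.
move=> [[C [unbC C_c]] cmin] [_ [_ [I [le [_ [[wo init] [[[B [unbB B_I]] Imin] _]]]]]]].
have I_c : ([set: I] #<= continuum)%card by rewrite -(card_le_eqr C_c); exact: Imin.
have c_I : (continuum #<= [set: I])%card by rewrite -(card_le_eqr B_I); exact: cmin.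
exists I, le; split=> //; first by move=> i /(card_le_trans I_c); exact: init.
by rewrite card_eq_le I_c.
Qed.

Lemma refinement_continuum (D S : set cantor_space) : card_is_b continuum -> b_scale D ->
  refinement sqsub_star D S -> (S #= continuum)%card.
Proof.
move=> [_ cmin] [_ [unbD _]] DS; rewrite card_eq_le subset_card_le //=.
by apply: card_le_trans (card_image_le enumeration S); apply/cmin/refinement_unbounded/unbD.
Qed.

Lemma enumerate_predicates (I : Type) (T : countType) : ([set: I] #= continuum)%card ->
  exists P : I -> T -> bool, forall Q, exists i, P i = Q.
Proof.
rewrite card_eq_le => /andP[_ /pcard_surjP[c c_surj]].
exists (fun i x => c i (choice.pickle x)) => Q.
have [i _ ci] := c_surj (fun n => if choice.unpickle n is Some x then Q x else false) Logic.I.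
by exists i; apply/funext => x; rewrite ci choice.pickleK.
Qed.

Lemma enumerate_functions (I : Type) : ([set: I] #= continuum)%card ->
  exists f : I -> nat -> nat, forall h, exists i, f i = h.
Proof.
move=> /(enumerate_predicates (nat * nat)%type)[P P_surj].
exists (fun i n => xget 0%N [set m | P i (n, m)]) => h.
have [i Pi] := P_surj (fun nm => nm.2 == h nm.1); exists i; apply/funext => n.
by case: xgetP => [m _|/(_ (h n))]; rewrite /= Pi /= ?eqxx // => /eqP.
Qed.

Lemma enumerate_set (I : Type) (S : set cantor_space) : ([set: I] #= continuum)%card ->
  (S #= continuum)%card ->
  exists s : I -> cantor_space, injective s /\ range s = S.
Proof.
move=> I_c S_c; have /card_set_bijP[s [s_in s_inj s_surj]] : ([set: I] #= S)%card.
  by rewrite (card_eqr S_c).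
exists s; split; first by move=> i j; apply: s_inj; rewrite inE.
by apply/seteqP; split=> // _ [i _ <-]; exact: s_in.
Qed.

(** * The refinement *)

(** The refinement is built by recursion along the well-order.  At stage [i] fewer than continuum
    many rates [G j] and [H j] have been prescribed, so they have a common bound, and [t i] is
    taken sparse for that bound.  If [G] lists all functions, then every function is a gap rate
    of all but fewer than continuum many points.  The relation [C] leaves room for a
    requirement through which the rate [H i] depends on the points built before stage [i]. *)
Lemma sparse_family (I : Type) (le : rel I) (s : I -> cantor_space) (f G : I -> nat -> nat)
    (C : I -> set cantor_space -> (nat -> nat) -> Prop) :
  card_is_b continuum -> wochoice.well_order le ->
  (forall i, ~ (continuum #<= below le i)%card) ->
  (forall i, infsets (s i)) -> (forall i n, (n < f i n)%N) ->
  exists (t : I -> cantor_space) (H : I -> nat -> nat),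
    [/\ forall i, infsets (t i) /\ sqsub_star (s i) (t i),
        forall i m, exists n, [/\ (m <= f i n)%N, t i (f i n)
          & forall x, (n < x < f i n)%N -> ~~ t i x],
        forall i j, ~ below le i j -> sparse (G i) (t j) /\ sparse (H i) (t j)
      & forall i, (exists h, C i (t @` below le i) h) -> C i (t @` below le i) (H i)].
Proof.
move=> b_c wo small inf_s gt_f.
pose R i (g : I -> cantor_space * (nat -> nat)) (b : cantor_space * (nat -> nat)) :=
  [/\ infsets b.1 /\ sqsub_star (s i) b.1,
      forall m, exists n, [/\ (m <= f i n)%N, b.1 (f i n)
        & forall x, (n < x < f i n)%N -> ~~ b.1 x],
      sparse (G i) b.1 /\ sparse b.2 b.1,
      forall j, below le i j -> sparse (G j) b.1 /\ sparse (g j).2 b.1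
    & (exists h, C i ((fst \o g) @` below le i) h) -> C i ((fst \o g) @` below le i) b.2].
have [g gP] : exists g, forall i, R i g (g i).
  apply: (wf_dependent_choice ((fun=> false), id) (below_well_founded wo)); last first.
    move=> i g g' b gg' [Rt Rf RG Rbelow RC]; split=> //.
      by move=> j ji; rewrite -gg' //; exact: Rbelow.
    by have <- : (fst \o g) @` below le i = (fst \o g') @` below le i
      by apply: eq_imagel => j ji; rewrite /= gg'.
  rewrite /R => i g; set Z := (fst \o g) @` below le i.
  have [H HP] : exists H, (exists h, C i Z h) -> C i Z H.
    have [[h Ch]|noC] := pselect (exists h, C i Z h); first by exists h.
    by exists id => /noC.
  have [q qP] := sparse_sqsub (inf_s i).
  have [K KP] := small_bounded (fun j n => maxn (G j n) ((g j).2 n)) b_c (small i).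
  pose rate n := (K n + G i n + H n + q n)%N.
  have [t [inf_t rate_t hit_t]] := sparse_hitting rate (gt_f i).
  have K_rate n : (K n <= rate n)%N by rewrite /rate; lia.
  have rate_le h : (forall n, (h n <= rate n)%N) -> sparse h t.
    by move=> h_le; apply: le_star_sparse rate_t; apply/le_starP; exists 0%N.
  exists (t, H); split=> //=.
  - split=> //; apply: qP => //; apply: rate_le => n; exact: leq_addl.
  - by split; apply: rate_le => n; rewrite /rate; lia.
  - move=> j ji; have /le_starP[N NP] := KP _ ji.
    by split; apply: le_star_sparse rate_t; apply/le_starP; exists N => n /NP;
      rewrite geq_max => /andP[Gn Hn]; apply: leq_trans (K_rate n).
exists (fst \o g), (snd \o g); split=> [i|i|i j nij|i]; try by have [] := gP i.
have [<-|ij] := pselect (i = j); first by have [] := gP i.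
have [_ _ _ Rbelow _] := gP j; apply: Rbelow.
by split=> //; exact: well_order_total nij.
Qed.
(** * Open sets and gaps *)

Definition agree (n : nat) (x y : cantor_space) : Prop := forall k, (k < n)%N -> x k = y k.

Lemma nbhs_agree (x : cantor_space) n : nbhs x [set y | agree n x y].
Proof.
elim: n => [|n IHn]; first by apply: filterE.
have xn : nbhs x [set y | y n = x n].
  apply: (@proj_continuous nat (fun=> bool) n x [set b | b = x n]).
  exact: (@discrete_set1 bool).
by apply: filterS2 IHn xn => y xy yn k; rewrite ltnS leq_eqVlt => /orP[/eqP->|/xy].
Qed.

(** A product topology is a supremum of initial topologies, so the claim amounts to the
    convergence to [x], in each coordinate, of the filter generated by the basic sets. *)
Lemma agree_nbhs (x : cantor_space) (A : set cantor_space) :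
  nbhs x A -> exists n, forall y, agree n x y -> A y.
Proof.
pose F := filter_from [set: nat] (fun n => [set y | agree n x y]).
have F_filter : Filter F.
  apply: filter_from_filter => [|m n _ _]; first by exists 0%N.
  exists (maxn m n) => // y xy; split=> k kn; apply: xy; rewrite leq_max kn ?orbT //.
suff Fx : F --> (x : cantor_space) by move=> /Fx[n _ nA]; exists n => y /nA.
apply/cvg_sup => i; apply/cvg_image; first by apply/seteqP; split=> // b _; exists (fun=> b).
move=> B Bx.
exists [set y : cantor_space | B (y i)]; last first.
  apply/seteqP; split=> [_ [y By <-]//|b Bb].
  by exists (fun=> b).
exists i.+1 => // y xy /=; rewrite -xy //; exact: nbhs_singleton Bx.
Qed.

Lemma open_subspaceP (Y : set cantor_space) (V : set (set_type Y)) :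
  open V <-> forall x, V x -> exists n, forall y, agree n (set_val x) (set_val y) -> V y.
Proof.
split=> [[A openA <-] x Ax|V_prefix].
  have [n nA] := agree_nbhs (open_nbhs_nbhs (conj openA Ax)).
  by exists n => y /nA.
rewrite openE => x Vx; have [n nV] := V_prefix _ Vx.
apply: (@filterS _ _ _ [set y | agree n (set_val x) (set_val y)]); first by move=> y /nV.
exact: (@initial_continuous _ _ (set_val : set_type Y -> cantor_space) x _ (nbhs_agree _ n)).
Qed.

(** The finite sets below [a] are finitely many; they are the sets [prefix_point w] for the words
    [w] of length [a]. *)
Definition prefix_point (w : seq bool) : cantor_space := nth false w.

Lemma prefix_point_fin w : Fin (prefix_point w).
Proof.
apply: (@sub_finite_set _ _ `I_(size w)); last exact: finite_II.
move=> n; rewrite /elts /prefix_point /= ltnNge => wn; apply/negP => le_wn.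
by rewrite nth_default in wn.
Qed.

Definition words (a : nat) : seq (seq bool) := [seq val w | w <- enum {: a.-tuple bool}].

Definition avoids (x : cantor_space) (a b : nat) : Prop :=
  forall k, (a <= k < b)%N -> ~~ x k.

Lemma truncation (x : cantor_space) a : exists w, w \in words a /\
  forall b, avoids x a b -> agree b (prefix_point w) x.
Proof.
exists (mkseq x a); split.
  apply/mapP; exists (mktuple (fun i : 'I_a => x i)); first by rewrite mem_enum.
  by rewrite /mkseq -val_enum_ord -map_comp.
move=> b xab k kb; rewrite /prefix_point.
have [ka|ak] := ltnP k a; first by rewrite nth_mkseq.
rewrite nth_default ?size_mkseq //; apply/esym/negbTE/xab.
by rewrite ak.
Qed.

(** Each of the finitely many sets below [a] belongs to [V] because of a finite initial segment.
    If [x] has no element in [[a, b)], where [b] exceeds the length of all these segments, then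
    [x] agrees up to [b] with one of these finite sets. *)
Lemma gap_open (Y V : set cantor_space) a :
  (forall w, w \in words a -> V (prefix_point w)) ->
  (forall x, V x -> exists n, forall y, Y y -> agree n x y -> V y) ->
  exists b, (a < b)%N /\ forall x, Y x -> avoids x a b -> V x.
Proof.
move=> V_words V_open.
have [n nP] : exists n : seq bool -> nat, forall w, w \in words a ->
    forall y, Y y -> agree (n w) (prefix_point w) y -> V y.
  have ex w : exists n, w \in words a ->
      forall y, Y y -> agree n (prefix_point w) y -> V y.
    have [wa|_] := boolP (w \in words a); last by exists 0%N.
    by have [n nV] := V_open _ (V_words _ wa); exists n => _.
  by have [n nP] := choice ex; exists n.
exists (maxn a.+1 (\max_(w <- words a) n w)); split; first by rewrite leq_maxl.
move=> x Yx xab; have [w [wa wx]] := truncation x a; apply: (nP _ wa _ Yx) => k kn.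
apply: (wx _ xab); apply: leq_trans kn _; rewrite leq_max; apply/orP; right.
by apply: leq_bigmax_seq.
Qed.
(** * Failure of the selection property for single sets *)

Definition singleton_point (m : nat) : cantor_space := fun k => k == m.

Lemma singleton_point_fin m : Fin (singleton_point m).
Proof.
apply: (@sub_finite_set _ _ [set m]); last exact: finite_set1.
by move=> k /eqP.
Qed.

(** The complement consists of the points whose first element after [n] is [m]; a point has at
    most one such [m], which makes the sets [not_next n m] a point-cofinite family. *)
Definition not_next (Y : set cantor_space) (n m : nat) : set (set_type Y) :=
  [set x : set_type Y | ~ (set_val x m /\ forall k, (n < k < m)%N -> ~~ set_val x k)].

Lemma next_unique (Y : set cantor_space) n m m' (x : set_type Y) : (n < m)%N -> (n < m')%N ->
  ~ not_next n m x -> ~ not_next n m' x -> m = m'.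
Proof.
move=> nm nm' /contrapT[xm gap] /contrapT[xm' gap'].
have [mm'|m'm|//] := ltngtP m m'.
  by have := gap' m; rewrite nm mm' xm => /(_ isT).
by have := gap m'; rewrite nm' m'm xm' => /(_ isT).
Qed.

Lemma not_next_open (Y : set cantor_space) n m : open (@not_next Y n m).
Proof.
apply/open_subspaceP => x nx; exists m.+1 => y xy [ym gap]; apply: nx; split.
  by rewrite xy.
by move=> k /andP[nk km]; rewrite xy ?gap ?nk // ltnS ltnW.
Qed.

Lemma not_next_singleton (Y : set cantor_space) n m m' (x : set_type Y) :
  set_val x = singleton_point m' -> ~ not_next n m x <-> m = m'.
Proof.
move=> x_m'; split=> [/contrapT[]|->]; first by rewrite x_m' => /eqP.
case; rewrite x_m'; split=> [|k /andP[_ km']]; first exact: eqxx.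
by rewrite /singleton_point neq_ltn km'.
Qed.

(** A member [not_next n m] determines [m]: the only singleton that it omits is [{m}]. *)
Lemma not_next_index (Y : set cantor_space) : Fin `<=` Y ->
  exists index : set (set_type Y) -> nat, forall n m, index (not_next n m) = m.
Proof.
move=> FinY; pose pt m : set_type Y := SigSub (mem_set (FinY _ (singleton_point_fin m))).
have ptP n m m' : ~ not_next n m (pt m') <-> m = m' by exact: not_next_singleton.
exists (fun W => xget 0%N [set m | ~ W (pt m)]) => n m.
by case: xgetP => [m' _ /ptP/esym//|/(_ m)]; case; apply/ptP.
Qed.

Definition not_next_cover (Y : set cantor_space) (n : nat) : set (set (set_type Y)) :=
  @not_next Y n @` [set m | (n < m)%N].

Lemma not_next_cover_Gamma (Y : set cantor_space) n : Fin `<=` Y ->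
  Gamma (@not_next_cover Y n).
Proof.
move=> FinY; have [index indexP] := not_next_index FinY; split; [split|split].
- split; last first.
    move=> [m _ full].
    pose pt : set_type Y := SigSub (mem_set (FinY _ (singleton_point_fin m))).
    have [_ /(_ erefl)] : ~ not_next n m pt <-> m = m by exact: not_next_singleton.
    by rewrite full; apply.
  apply/seteqP; split=> // x _.
  have [xn|nxn] := pselect (not_next n n.+1 x).
    by exists (not_next n n.+1) => //; exists n.+1 => /=.
  exists (not_next n n.+2); first by exists n.+2 => /=.
  apply: contrapT => /(next_unique _ _ nxn)-/(_ (ltnSn n) (leqnSn n.+1))/eqP.
  by rewrite ltn_eqF.
- by move=> _ [m _ <-]; exact: not_next_open.
- move=> /(finite_image index)/finite_bounded[N NP].
  suff /NP : (index @` not_next_cover n) (maxn n.+1 N) by rewrite ltnNge leq_maxr.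
  exists (not_next n (maxn n.+1 N)); last exact: indexP.
  by exists (maxn n.+1 N) => //=; rewrite leq_maxl.
- move=> x; have [[m [nm xm]]|none] := pselect (exists m, (n < m)%N /\ ~ not_next n m x).
    apply: (@sub_finite_set _ _ [set not_next n m]); last exact: finite_set1.
    by move=> _ [[m' nm' <-]] xm'; rewrite (next_unique nm' nm xm' xm).
  apply: (@sub_finite_set _ _ set0); last exact: finite_set0.
  by move=> _ [[m nm <-]] xm; apply: none; exists m.
Qed.

(** A selection from the covers [not_next_cover n] is a function [f] with [n < f n], and a point
    that infinitely often jumps over [n] directly to [f n] is omitted infinitely often. *)
Lemma hitting_not_S1 (Y : set cantor_space) : Fin `<=` Y ->
  (forall f : nat -> nat, (forall n, (n < f n)%N) -> exists2 t, Y t &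
     forall m, exists n, [/\ (m <= f n)%N, t (f n) & forall x, (n < x < f n)%N -> ~~ t x]) ->
  ~ S1 Gamma Gamma (set_type Y).
Proof.
move=> FinY hit /(_ (@not_next_cover Y) (fun n => not_next_cover_Gamma n FinY)).
move=> [V [V_cover [_ [_ V_gamma]]]].
have [index indexP] := not_next_index FinY.
have f_ex n : exists m, (n < m)%N /\ V n = not_next n m.
  by have [m nm <-] := V_cover n; exists m.
have [f fP] := choice f_ex.
have [t Yt t_hit] := hit f (fun n => (fP n).1).
pose x : set_type Y := SigSub (mem_set Yt).
have /(finite_image index)/finite_bounded[N NP] := V_gamma x.
have [n [Nf tf gap]] := t_hit N.
suff /NP : (index @` [set W | range V W /\ ~ W x]) (f n) by rewrite ltnNge Nf.
exists (V n); last first.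
  by have [nf ->] := fP n; exact: indexP.
by split; [exists n|have [_ ->] := fP n; apply].
Qed.

(** * Selecting two sets from each cover *)

(** A proper subset misses some point, so it can occur only finitely often among the [V n];
    hence the range is infinite. *)
Lemma eventual_cover_Gamma (X : topologicalType) (V : nat -> set X) :
  (forall n, open (V n) /\ V n <> setT) ->
  (forall x, exists N, forall n, (N <= n)%N -> V n x) -> Gamma (range V).
Proof.
move=> V_open V_ev; split; [split|split].
- split; last by move=> [n _]; exact: (V_open n).2.
  apply/seteqP; split=> // x _; have [N NP] := V_ev x.
  by exists (V N); [exists N|exact: NP].
- by move=> _ [n _ <-]; exact: (V_open n).1.
- move=> fin; apply: infinite_nat.
  apply: (@sub_finite_set _ _ (\bigcup_(W in range V) [set n | V n = W])).
    by move=> n _; exists (V n) => //; exists n.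
  apply: bigcup_finite => // _ [m _ <-].
  have [x nx] : exists x, ~ V m x.
    apply: contrapT => none; apply: (V_open m).2; apply/seteqP; split=> // x _.
    by apply: contrapT => nx; apply: none; exists x.
  have [N NP] := V_ev x; apply: (@sub_finite_set _ _ `I_N); last exact: finite_II.
  move=> n /= nm; rewrite ltnNge; apply/negP => /NP; rewrite nm; exact: nx.
- move=> x; have [N NP] := V_ev x.
  apply: (@sub_finite_set _ _ (V @` `I_N)); last exact/finite_image/finite_II.
  move=> _ [[n _ <-] nx]; exists n => //=; rewrite ltnNge; apply/negP => /NP; exact: nx.
Qed.

Lemma Gamma_sequence (X : topologicalType) (U : set (set X)) : Gamma U ->
  exists v : nat -> set X, (forall k, U (v k)) /\
    forall x, exists K, forall k, (K <= k)%N -> v k x.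
Proof.
move=> [_ [/infiniteP/pcard_leP[v] U_pc]]; exists v; split=> [k|x].
  by apply: (@funS _ _ setT U v).
have v_inj : injective v by move=> i j vij; apply: (@inj _ _ setT v); rewrite ?inE.
have /(finite_preimage (f := v))/finite_bounded[|N NP] := U_pc x; first by move=> i j _ _ /v_inj.
exists N => k Nk; apply: contrapT => nvx; have /NP : (v @^-1` [set V | U V /\ ~ V x]) k.
  by split=> //; apply: (@funS _ _ setT U v).
by rewrite ltnNge Nk.
Qed.

(** This is where two sets per cover are needed: a sparse set has at most one element in the
    union of two adjacent intervals, hence it avoids one of them, but not a prescribed one. *)
Lemma sparse_avoids_one (g : nat -> nat) (x : cantor_space) N a b c :
  (forall a b, (N <= a)%N -> x a -> (a < b)%N -> x b -> (g a < b)%N) ->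
  (N <= a)%N -> (a <= b)%N -> (forall e, (a <= e)%N -> (c <= g e)%N) ->
  avoids x a b \/ avoids x b c.
Proof.
move=> gx Na ab cg; have [|hit] := pselect (avoids x a b); first by left.
right=> k /andP[bk kc]; apply/negP => xk; apply: hit => e /andP[ae eb]; apply/negP => xe.
have /(gx e k (leq_trans Na ae) xe)/(_ xk) := leq_trans eb bk.
by rewrite ltnNge => /negP; apply; apply: leq_trans (cg _ ae); exact: ltnW.
Qed.

(** For each [a] some late member of the sequence contains the finitely many sets below [a], so
    that [gap_open] applies to it. *)
Lemma gap_sequence (Y : set cantor_space) (v : nat -> set (set_type Y)) : Fin `<=` Y ->
  (forall k, open (v k)) -> (forall x, exists K, forall k, (K <= k)%N -> v k x) ->
  forall a, exists kb : nat * nat, [/\ (a <= kb.1)%N, (a < kb.2)%N &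
    forall x, avoids (set_val x) a kb.2 -> v kb.1 x].
Proof.
move=> FinY v_open v_ev a.
pose pt w : set_type Y := SigSub (mem_set (FinY _ (prefix_point_fin w))).
have [K KP] := choice (fun w => v_ev (pt w)).
pose k := maxn a (\max_(w <- words a) K w).
have [||b [ab bP]] := @gap_open Y (set_val @` v k) a.
- move=> w wa; exists (pt w) => //; apply: KP; rewrite leq_max; apply/orP; right.
  by apply: leq_bigmax_seq.
- move=> _ [x vx <-]; have [n nP] := (open_subspaceP _).1 (v_open k) x vx.
  by exists n => y Yy xy; exists (SigSub (mem_set Yy)) => //; exact: nP.
exists (k, b); split=> //=; first exact: leq_maxl.
move=> x /bP[|y vy /val_inj <- //]; exact: set_valP.
Qed.

(** The rate [g] depends only on the gaps attached to the covers.  Once [g] is fixed, the points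
    that are not [g]-sparse are few, so that their moduli of point-cofiniteness have a common
    bound [h]; selecting at a position [a n] beyond [h n] serves these points.  The two sets
    chosen in the [n]-th cover work for sparse points with gaps in two adjacent intervals. *)
Lemma sparse_U2 (Y : set cantor_space) : Fin `<=` Y ->
  (forall (g : nat -> nat) (u : cantor_space -> nat -> nat),
     exists h, forall x, Y x -> ~ sparse g x -> le_star (u x) h) ->
  U2 Gamma Gamma (set_type Y).
Proof.
move=> FinY small U U_Gamma.
have [v vP] := choice (fun n => Gamma_sequence (U_Gamma n).1).
have v_open n k : open (v n k).
  by have [[[_ U_open] _] _] := U_Gamma n; apply: U_open; exact: (vP n).1.
have gap n a : exists kb : nat * nat, [/\ (a <= kb.1)%N, (a < kb.2)%N &
    forall x, avoids (set_val x) a kb.2 -> v n kb.1 x].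
  by apply: gap_sequence => //; exact: (vP n).2.
have [kb kbP] := choice (fun na : nat * nat => gap na.1 na.2).
pose k n a := (kb (n, a)).1; pose b n a := (kb (n, a)).2.
have k_ge n a : (a <= k n a)%N by have [] := kbP (n, a).
have b_gt n a : (a < b n a)%N by have [] := kbP (n, a).
have v_gap n a x : avoids (set_val x) a (b n a) -> v n (k n a) x by have [_ _] := kbP (n, a); apply.
pose g e := (\max_(n < e.+1) \max_(a < e.+1) b n (b n a))%N.
have g_ge n a e : (n <= e)%N -> (a <= e)%N -> (b n (b n a) <= g e)%N.
  rewrite -!(ltnS _ e) => ne ae.
  apply: leq_trans (@leq_bigmax _ (fun n : 'I_e.+1 => \max_(a < e.+1) b n (b n a))%N (Ordinal ne)).
  exact: (@leq_bigmax _ (fun a : 'I_e.+1 => b n (b n a)) (Ordinal ae)).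
have u_ex (x : cantor_space) : exists u : nat -> nat, forall (y : set_type Y), set_val y = x ->
    forall n k, (u n <= k)%N -> v n k y.
  have [Yx|nYx] := pselect (Y x); last first.
    by exists id => y yx; case: nYx; rewrite -yx; exact: set_valP.
  have [u uP] := choice (fun n => (vP n).2 (SigSub (mem_set Yx))).
  exists u => y yx n k' /uP; suff -> : SigSub (mem_set Yx) = y by [].
  exact/val_inj.
have [u uP] := choice u_ex; have [h hP] := small g u.
(* The maximum with [n] moves the intervals to infinity, beyond each sparsity threshold. *)
pose a n := maxn n (h n).
exists (fun n => v n (k n (a n))), (fun n => v n (k n (b n (a n)))); split.
  by move=> n; split; exact: (vP n).1.
apply: eventual_cover_Gamma => [n|x].
  split; first by apply: openU.
  move=> full; have [[[[_ U_T] _] _] no_two] := U_Gamma n; apply: no_two.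
  set V := v n _ in full *; set W := v n _ in full.
  have UV : U n V by exact: (vP n).1.
  have UW : U n W by exact: (vP n).1.
  exists V, W; split=> //; split=> //; split.
    by move=> VW; apply: U_T; rewrite -full VW setUid -VW.
  split; first by rewrite bigcup_setU !bigcup_set1.
  by case=> VT; apply: U_T; rewrite VT.
have [[N NP]|nsp] := pselect (sparse g (set_val x)).
  exists N => n Nn; have na : (n <= a n)%N by exact: leq_maxl.
  have [||e ae|/v_gap|/v_gap] :=
    @sparse_avoids_one g (set_val x) N (a n) (b n (a n)) (b n (b n (a n))) NP.
  - exact: leq_trans Nn na.
  - exact/ltnW/b_gt.
  - by apply: g_ge => //; exact: leq_trans ae.
  - by left.
  - by right.
have /le_starP[N NP] := hP _ (set_valP x) nsp.
exists N => n Nn; left; apply: uP erefl _ _ _; apply: leq_trans (NP _ Nn) _.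
apply: leq_trans (k_ge _ _); exact: leq_maxr.
Qed.
(** * Covers of finite sets *)

(** Lists of words code the clopen sets.  There are countably many of them, so the sequences of
    families of codes can be listed in a family of length continuum. *)
Definition in_cylinders (C : seq (seq bool)) (x : cantor_space) : bool :=
  has (fun w => mkseq x (size w) == w) C.

Lemma in_cylinders_open C x : in_cylinders C x ->
  exists n, forall y, agree n x y -> in_cylinders C y.
Proof.
move=> /hasP[w Cw /eqP xw]; exists (size w) => y xy; apply/hasP; exists w => //.
by apply/eqP; rewrite -[RHS]xw; apply/eq_in_map => k; rewrite mem_iota => /andP[_ kw]; rewrite xy.
Qed.

Definition omega_codes (A : nat * seq (seq bool) -> bool) (Z : set cantor_space) : Prop :=
  forall n (F : seq cantor_space), (forall x, x \in F -> Z x \/ Fin x) ->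
    exists C, A (n, C) /\ forall x, x \in F -> in_cylinders C x.

(** The selection is required to work for the points of [Z] together with arbitrary [h]-sparse
    points, so that it survives the addition of sparse points at later stages. *)
Definition captures (A : nat * seq (seq bool) -> bool) (Z : set cantor_space)
    (h : nat -> nat) : Prop :=
  exists sel : nat -> seq (seq bool), (forall n, A (n, sel n)) /\
    forall F : seq cantor_space, (forall x, x \in F -> Z x \/ sparse h x) ->
      exists n, forall x, x \in F -> in_cylinders (sel n) x.

(** On pairs of a cover and a member, consider for each [z] in [Z] the pairs whose member contains
    [z], and for each [k] the pairs beyond [k] whose member contains the finite sets below [k].
    Since every finite set is contained in a member of every cover, this family is centered,
    and a pseudointersection is a selection that is point-cofinite on [Z]. *)
Lemma omega_pseudointersection (A : nat * seq (seq bool) -> bool) (Z : set cantor_space) :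
  card_is_p continuum -> ~ (continuum #<= Z)%card -> omega_codes A Z ->
  exists q : nat -> nat * seq (seq bool),
    [/\ forall k, A (q k), forall k, (k <= (q k).1)%N,
        forall k w, w \in words k -> in_cylinders (q k).2 (prefix_point w)
      & forall z, Z z -> exists K, forall k, (K <= k)%N -> in_cylinders (q k).2 z].
Proof.
move=> p_c small omegaA.
pose decode m : option (nat * seq (seq bool)) := choice.pickle_inv m.
pose holding (P : pred (nat * seq (seq bool))) : cantor_space :=
  fun m => if decode m is Some nC then P nC else false.
have holdingP P nC : holding P (choice.pickle nC) = P nC.
  by rewrite /holding /decode choice.pickleK_inv.
pose E z := holding (fun nC => in_cylinders nC.2 z).
pose contains_words C k := all (fun w => in_cylinders C (prefix_point w)) (words k).
pose W k := holding (fun nC => [&& (k <= nC.1)%N, A nC & contains_words nC.2 k]).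
pose family := (E @` Z) `|` range W.
have family_small : ~ (continuum #<= family)%card.
  move=> /continuum_setU_countable c_EZ; apply: small.
  apply: card_le_trans (card_image_le E Z); apply: c_EZ.
  exact: sub_countable (card_image_le W setT) _.
have family_centered : centered family.
  move=> F finF F_family.
  have zk_ex a : exists zk : cantor_space * nat, (Z zk.1 \/ Fin zk.1) /\
      (family a -> a = E zk.1 \/ a = W zk.2).
    have [[[z Zz <-]|[k _ <-]]|nfam] := pselect (family a).
    - by exists (z, 0%N); split; [left|left].
    - by exists (prefix_point [::], k); split; [right; exact: prefix_point_fin|right].
    - by exists (prefix_point [::], 0%N); split=> //; right; exact: prefix_point_fin.
  have [zk zkP] := choice zk_ex.
  have /finite_seqP[s Fs] := finF.
  pose K := \max_(a <- s) (zk a).2.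
  have [f fP] : exists f : nat -> nat, forall n, (K <= n)%N -> exists C : seq (seq bool),
      f n = choice.pickle (n, C) /\ forall a, F a -> a (f n).
    have f_ex n : exists m, (K <= n)%N -> exists C : seq (seq bool),
        m = choice.pickle (n, C) /\ forall a, F a -> a m.
      have [|C [AC CP]] := omegaA n
        ([seq (zk a).1 | a <- s] ++ [seq prefix_point w | k <- iota 0 K.+1, w <- words k]).
        move=> x; rewrite mem_cat => /orP[/mapP[a _ ->]|/allpairsPdep[k [w [_ _ ->]]]].
          exact: (zkP a).1.
        by right; exact: prefix_point_fin.
      exists (choice.pickle (n, C)) => Kn; exists C; split=> // a Fa.
      have sa : a \in s by move: Fa; rewrite Fs.
      have [_ /(_ (F_family _ Fa))[->|->]] := zkP a; rewrite /E /W holdingP /=.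
        by apply: CP; rewrite mem_cat; apply/orP; left; apply/mapP; exists a.
      have aK : ((zk a).2 <= K)%N by apply: leq_bigmax_seq.
      rewrite AC (leq_trans aK Kn) /=; apply/allP => w wa; apply: CP.
      rewrite mem_cat; apply/orP; right; apply/allpairsPdep.
      by exists (zk a).2, w; split=> //; rewrite mem_iota.
    by have [f fP] := choice f_ex; exists f.
  pose index m := if decode m is Some nC then nC.1 else 0%N.
  move=> /(finite_image index)/finite_bounded[N NP].
  have [C [fC fF]] := fP (maxn K N) (leq_maxl _ _).
  suff /NP : (index @` \bigcap_(a in F) elts a) (maxn K N) by rewrite ltnNge leq_maxr.
  by exists (f (maxn K N)) => //; rewrite fC /index /decode choice.pickleK_inv.
have family_inf : family `<=` infsets.
  move=> a fam_a; have := family_centered [set a] (finite_set1 _).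
  by rewrite bigcap_set1; apply => _ ->.
have [P [infP almost]] := small_pseudointersection p_c family_inf family_centered family_small.
have q_ex k : exists nC : nat * seq (seq bool),
    [/\ P (choice.pickle nC), (k <= choice.pickle nC)%N & W k (choice.pickle nC)].
  have famW : family (W k) by right; exists k.
  have /finite_bounded[N NP] := almost _ famW.
  have [c []] := infinite_cofinal infP (maxn N k); rewrite geq_max => /andP[Nc kc] Pc.
  have Wc : W k c.
    apply: contrapT => nW; have : (elts P `\` elts (W k)) c by split.
    by move=> /NP; rewrite ltnNge Nc.
  case dc : (decode c) => [nC|]; last by move: Wc; rewrite /W /holding dc.
  have c_nC : choice.pickle nC = c.
    by have := @choice.pickle_invK (nat * seq (seq bool))%type c; move: dc; rewrite /decode => ->.
  by exists nC; rewrite c_nC.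
have [q qP] := choice q_ex.
have WP k : [&& (k <= (q k).1)%N, A (q k) & contains_words (q k).2 k].
  by have [_ _] := qP k; rewrite /W holdingP.
exists q; split=> [k|k|k w wk|z Zz].
- by have /and3P[] := WP k.
- by have /and3P[] := WP k.
- by have /and3P[_ _ /allP] := WP k; apply.
- have famE : family (E z) by left; exists z.
  have /finite_bounded[N NP] := almost _ famE.
  exists N => k Nk; have [Pk kk _] := qP k; apply: contrapT => nz.
  have /NP : (elts P `\` elts (E z)) (choice.pickle (q k)).
    by split=> //; rewrite /elts /= /E holdingP.
  by rewrite ltnNge (leq_trans Nk kk).
Qed.

(** Pigeonhole: a sparse set meets at most one of the [k + 1] intervals from [m r] on, and there
    are at most [k] sets, hence some interval is avoided by all of them. *)
Lemma common_gap (m : nat -> nat) (F : seq cantor_space) (r k : nat) (good : set cantor_space) :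
  (size F <= k)%N ->
  (forall x, x \in F -> ~ good x -> forall i j, (i < j)%N -> (j <= k)%N ->
     ~ avoids x (m (r + i)%N) (m (r + i).+1) -> avoids x (m (r + j)%N) (m (r + j).+1)) ->
  exists j, (j <= k)%N /\ forall x, x \in F -> good x \/ avoids x (m (r + j)%N) (m (r + j).+1).
Proof.
move=> Fk F_sparse.
have hit_ex x : exists i, x \in F -> ~ good x -> forall j, (j <= k)%N -> j <> i ->
    avoids x (m (r + j)%N) (m (r + j).+1).
  have [[i [ik hit]]|none] :=
    pselect (exists i, (i <= k)%N /\ ~ avoids x (m (r + i)%N) (m (r + i).+1)).
    exists i => Fx nx j jk ji; have [ij|ij|ij] := ltngtP i j; last by case: ji.
      exact: F_sparse hit.
    apply: contrapT => hitj; apply: hit; exact: F_sparse hitj.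
  exists 0%N => _ _ j jk _; apply: contrapT => hit; apply: none; by exists j.
have [hit hitP] := choice hit_ex.
have [j [jk jF]] : exists j, (j <= k)%N /\ j \notin [seq hit x | x <- F].
  apply: contrapT => all_hit.
  have /(uniq_leq_size (iota_uniq 0 k.+1)) : {subset iota 0 k.+1 <= [seq hit x | x <- F]}.
    move=> j; rewrite mem_iota add0n ltnS => /andP[_ jk].
    by apply: contrapT => /negP jF; apply: all_hit; exists j.
  by rewrite size_iota size_map ltnNge Fk.
exists j; split=> // x Fx; have [|nx] := pselect (good x); [by left|right].
apply: hitP => // jx; move: jF; rewrite jx; apply/negP/negPn; exact: map_f.
Qed.

(** The sequence given by the pseudointersection is thinned out to positions [m r] such that the
    member chosen at [m r] contains all points without elements in [[m r, m r.+1)], and such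
    that distinct positions belong to distinct covers.  A finite set of points then splits into
    points of [Z], which belong to almost all members, and sparse points, which share a gap. *)
Lemma small_captures (A : nat * seq (seq bool) -> bool) (Z : set cantor_space) :
  card_is_p continuum -> ~ (continuum #<= Z)%card -> omega_codes A Z ->
  exists h, captures A Z h.
Proof.
move=> p_c small omegaA.
have [q [Aq q_ge q_words q_Z]] := omega_pseudointersection p_c small omegaA.
have next_ex a : exists b,
    [/\ (a < b)%N, ((q a).1 < b)%N & forall x, avoids x a b -> in_cylinders (q a).2 x].
  have [||b [ab bP]] := @gap_open setT (in_cylinders (q a).2) a; first exact: q_words.
    by move=> x /in_cylinders_open[n nP]; exists n => y _; exact: nP.
  exists (maxn b (q a).1.+1); split; [by rewrite leq_max ab|by rewrite leq_maxr|].
  move=> x xab; apply: bP => // k /andP[ak kb]; apply: xab.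
  by rewrite ak leq_max kb.
have [next nextP] := choice next_ex.
pose m r := iter r next 0%N.
have m_lt : {homo m : i j / (i < j)%N}.
  by apply: homo_ltn => [? ? ?|k]; [exact: ltn_trans|have [] := nextP (m k)].
have m_le : {homo m : i j / (i <= j)%N} by exact: ltnW_homo.
have m_ge r : (r <= m r)%N by elim: r => // r /leq_ltn_trans; apply; exact: m_lt.
have sel_ex n : exists C, A (n, C) /\ forall r, n = (q (m r)).1 -> C = (q (m r)).2.
  have [[r nr]|none] := pselect (exists r, n = (q (m r)).1); last first.
    have [|C [AC _]] := omegaA n [::]; first by [].
    by exists C; split=> // r nr; case: none; exists r.
  exists (q (m r)).2; split; first by rewrite nr -surjective_pairing.
  move=> r' nr'; suff -> : r = r' by [].
  have lt_next i j : (i < j)%N -> ((q (m i)).1 < (q (m j)).1)%N.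
    move=> ij; apply: leq_trans (q_ge (m j)); apply: leq_trans (m_le _ _ ij).
    by have [] := nextP (m i).
  by have [/lt_next|/lt_next|//] := ltngtP r r'; rewrite -nr -nr' ltnn.
have [sel selP] := choice sel_ex.
(* If at most [r] points are to share one of [r + 1] intervals starting at [m r], an element [e]
   of one of these intervals is at least [r], so [m (e + e).+1] is beyond the last of them. *)
exists (fun e => m (e + e).+1); exists sel; split=> [n|F F_good]; first exact: (selP n).1.
have N_ex x : exists N, x \in F ->
    (forall k, (N <= k)%N -> in_cylinders (q k).2 x) \/
    (forall a b, (N <= a)%N -> x a -> (a < b)%N -> x b -> (m (a + a).+1 < b)%N).
  have [/F_good[/q_Z[N NP]|[N NP]]|nFx] := pselect (x \in F).
  3: by exists 0%N => /nFx.
    by exists N => _; left.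
  by exists N => _; right.
have [N NP] := choice N_ex.
pose r := maxn (\max_(x <- F) N x) (size F).
have Nr x : x \in F -> (N x <= r)%N.
  by move=> Fx; rewrite leq_max; apply/orP; left; apply: leq_bigmax_seq.
have [||j [jF jP]] := @common_gap m F r (size F)
    [set x | forall k, (N x <= k)%N -> in_cylinders (q k).2 x]; first exact: leqnn.
  move=> x Fx ngood i j ij jF hit k /andP[jk kj]; apply/negP => xk; apply: hit => e /andP[ie ei].
  apply/negP => xe; have [//|sp] := NP _ Fx.
  have re : (r + i <= e)%N by exact: leq_trans (m_ge _) ie.
  have Ne : (N x <= e)%N by apply: leq_trans (Nr _ Fx) _; apply: leq_trans re; rewrite leq_addr.
  have ek : (e < k)%N.
    by apply: leq_trans ei (leq_trans _ jk); apply: m_le; rewrite -addnS leq_add2l.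
  have := ltn_trans (sp _ _ Ne xe ek xk) kj.
  rewrite ltnNge => /negP; apply; apply: m_le; rewrite ltnS.
  have : (size F <= r)%N by exact: leq_maxr.
  lia.
exists (q (m (r + j)%N)).1 => x Fx.
have [_ /(_ _ erefl) ->] := selP (q (m (r + j)%N)).1.
have [good|gap] := jP _ Fx.
  by apply: good; apply: leq_trans (Nr _ Fx) _; apply: leq_trans (m_ge _); rewrite leq_addr.
by have [_ _] := nextP (m (r + j)%N); apply.
Qed.

(** Each open cover is refined by a family of clopen sets that still covers all finite sets, since
    membership of finitely many points in an open set is decided by finite initial segments. *)
Lemma captures_S1_Omega (Y : set cantor_space) : Fin `<=` Y ->
  (forall A, omega_codes A Y -> exists Z h, captures A Z h /\
     forall x, Y x -> Z x \/ sparse h x) ->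
  S1 Omega Omega (set_type Y).
Proof.
move=> FinY capt U U_Omega.
pose A (nC : nat * seq (seq bool)) :=
  `[< exists V, U nC.1 V /\ forall x : set_type Y, in_cylinders nC.2 (set_val x) -> V x >].
have [|Z [h [[sel [selA selP]] YZh]]] := capt A.
  move=> n F F_Y.
  have FY x : x \in F -> Y x by move=> /F_Y[|/FinY].
  have [[_ U_open] U_fin] := U_Omega n.
  have fin : finite_set ((set_val : set_type Y -> cantor_space) @^-1` [set` F]).
    by apply: finite_preimage (finite_seq F) => x y _ _; exact: val_inj.
  have [V [UV FV]] := U_fin _ fin.
  have N_ex x : exists n, x \in F -> forall y : set_type Y, agree n x (set_val y) -> V y.
    have [Fx|_] := boolP (x \in F); last by exists 0%N.
    have [|N NP] := (open_subspaceP V).1 (U_open _ UV) (SigSub (mem_set (FY _ Fx))).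
      exact: FV.
    by exists N.
  have [N NP] := choice N_ex.
  exists [seq mkseq x (N x) | x <- F]; split.
    apply/asboolP; exists V; split=> // y /hasP[_ /mapP[x Fx ->]]; rewrite size_mkseq => /eqP yx.
    apply: NP Fx _ _ => k kN.
    by have := congr1 (fun w => nth false w k) yx; rewrite !nth_mkseq.
  move=> x Fx; apply/hasP; exists (mkseq x (N x)); first by apply/mapP; exists x.
  by rewrite size_mkseq.
have V_ex n : exists V, U n V /\ forall x : set_type Y, in_cylinders (sel n) (set_val x) -> V x.
  by have /asboolP := selA n.
have [V VP] := choice V_ex.
have V_fin (F : set (set_type Y)) : finite_set F -> exists n, F `<=` V n.
  move=> /(finite_image set_val)/finite_seqP[s Fs].
  have s_F x : F x -> set_val x \in s.
    by move=> Fx; have : (set_val @` F) (set_val x) by [exists x]; rewrite Fs.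
  have [|n nP] := selP s.
    move=> x sx; apply: YZh; have : (set_val @` F) x by rewrite Fs.
    by move=> [y _ <-]; exact: set_valP.
  by exists n => x Fx; apply: (VP n).2; apply: nP; exact: s_F.
exists V; split=> [n|]; first exact: (VP n).1.
split; [split; [split|]|] => [|||F finF].
- apply/seteqP; split=> // x _; have [n nP] := V_fin [set x] (finite_set1 _).
  by exists (V n); [exists n|exact: nP].
- by move=> [n _ Vn]; have [[[_ nT] _] _] := U_Omega n; apply: nT; rewrite -Vn; exact: (VP n).1.
- by move=> _ [n _ <-]; have [[_ U_open] _] := U_Omega n; apply: U_open; exact: (VP n).1.
- by have [n nP] := V_fin F finF; exists (V n); split=> //; exists n.
Qed.
(** * The theorem *)

Theorem theorem9p7 (b_eq_c : card_is_b continuum)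
    (S : set cantor_space) (S_inf : S `<=` infsets)
    (S_refines : exists D, b_scale D /\ refinement sqsub_star D S) :
  (exists S' : set cantor_space,
     refinement sqsub_star S S' /\
     U2 Gamma Gamma (set_type (S' `|` Fin)) /\
     ~ S1 Gamma Gamma (set_type (S' `|` Fin))) /\
  (card_is_p continuum ->
   exists S' : set cantor_space,
     refinement sqsub_star S S' /\
     U2 Gamma Gamma (set_type (S' `|` Fin)) /\
     ~ S1 Gamma Gamma (set_type (S' `|` Fin)) /\
     S1 Omega Omega (set_type (S' `|` Fin))).
Proof.
have [D [scaleD DS]] := S_refines.
have [I [le [wo small I_c]]] := continuum_index b_eq_c scaleD.
have [s [s_inj s_S]] := enumerate_set I_c (refinement_continuum b_eq_c scaleD DS).
have [f f_surj] := enumerate_functions I_c.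
have [A A_surj] := enumerate_predicates (nat * seq (seq bool))%type I_c.
have inf_s i : infsets (s i) by apply: S_inf; rewrite -s_S; exists i.
have [|t [H [t_ref t_hit t_sparse t_capt]]] := @sparse_family I le s
  (fun i n => (f i n + n).+1) f (fun i Z h => captures (A i) Z h) b_eq_c wo small inf_s.
  by move=> i n; rewrite ltnS leq_addl.
have FinY : Fin `<=` range t `|` Fin by move=> x; right.
have refS : refinement sqsub_star S (range t).
  split=> //; split; first by move=> _ [i _ <-]; exact: (t_ref i).1.
  have phi_ex a : exists b, forall i, s i = a -> b = t i.
    have [[i <-]|none] := pselect (exists i, s i = a); last first.
      by exists a => i sia; case: none; exists i.
    by exists (t i) => j /s_inj->.
  have [phi phiP] := choice phi_ex; exists phi; rewrite -s_S; split; last first.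
    by move=> _ [i _ <-]; rewrite (phiP _ i erefl); exact: (t_ref i).2.
  apply/seteqP; split=> [_ [_ [i _ <-] <-]|_ [i _ <-]].
    by rewrite (phiP _ i erefl); exists i.
  by exists (s i); [exists i|exact: phiP].
have U2Y : U2 Gamma Gamma (set_type (range t `|` Fin)).
  apply: sparse_U2 => // g u; have [i fi] := f_surj g.
  have [h hP] := small_bounded (fun j => u (t j)) b_eq_c (small i).
  exists h => x [[j _ <-]|/fin_sparse gx] nsparse; last by case: nsparse.
  apply: hP; apply: contrapT => nji; apply: nsparse.
  by rewrite -fi; exact: (t_sparse i j nji).1.
have not_S1 : ~ S1 Gamma Gamma (set_type (range t `|` Fin)).
  apply: hitting_not_S1 => // g g_gt; have [i fi] := f_surj (fun n => (g n - n).-1).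
  have gE n : (f i n + n).+1 = g n by rewrite fi; have := g_gt n; lia.
  exists (t i); first by left; exists i.
  by move=> m; have [n] := t_hit i m; rewrite gE; exists n.
split; first by exists (range t).
move=> p_c; exists (range t); split=> //; split=> //; split=> //.
apply: captures_S1_Omega => // B omegaB; have [i Ai] := A_surj B.
exists (t @` below le i), (H i); split; last first.
  move=> x [[j _ <-]|/fin_sparse]; last by right.
  have [ji|nji] := pselect (below le i j); first by left; exists j.
  by right; exact: (t_sparse i j nji).2.
rewrite -Ai; apply: t_capt; rewrite Ai; apply: small_captures => //.
  by move=> /card_le_trans-/(_ _ _ (card_image_le t _)); exact: small.
move=> n F F_Z; apply: omegaB => x /F_Z[[j _ <-]|]; last by right.
by left; left; exists j.
Qed.
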